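(* Let $G$ be a block graph of order $p$ and diameter $d(G)\ge 2$. Then $$rn(G)\ \ge\ (p-1)\bigl(d(G)+\varepsilon(G)\bigr)-2L(G)+\varepsilon(G).$$ Moreover, equality holds if and only if there exists an ordering $\vec u=(u_0,u_1,\ldots,u_{p-1})$ of $V(G)$ such that all of the following hold: (a) $L(u_0)+L(u_{p-1})=\varepsilon(G)$; (b) for $0\le i\le p-2$, $u_i$ and $u_{i+1}$ are in different branches when $|W(G)|=1$, and are in opposite branches when $|W(G)|\ge 2$ (i.e. $\rho(u_i,u_{i+1})=\phi(u_i,u_{i+1})=0$ and $\delta(u_i,u_{i+1})=1-\varepsilon(G)$); (c) the mapping $f$ on $V(G)$ defined by $f(u_0)=0$ and $f(u_{i+1})=f(u_i)+d(G)+\varepsilon(G)-L(u_{i+1})-L(u_i)$ for $0\le i\le p-2$ is a radio labeling of $G$.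
   Context: Graphs are finite and simple. For a connected graph $G$, $d(u,v)$ is the distance and $d(G)$ the diameter. A radio labeling of $G$ is a map $f:V(G)\to\{0,1,2,\ldots\}$ with $|f(u)-f(v)|\ge d(G)+1-d(u,v)$ for all distinct $u,v$. Its span is $\max\{|f(u)-f(v)|:u,v\in V(G)\}$, and $rn(G)$ is the minimum span of a radio labeling of $G$. A block is a maximal connected induced subgraph without cut-vertices (of itself). A block graph is a connected graph all of whose blocks are complete graphs; between any two vertices $u,v$ of it there is a unique shortest path ($(u,v)$-geodesic) $P_{uv}$. The weight at $v$ is $wt(v)=\sum_{u\in V(G)}d(u,v)$, and $W(G)$ is the set of vertices of minimum weight (weight centers). If $|W(G)|\ge2$, then $W(G)$ is contained in a (unique) block, called the central block. The central vertices of $G$ are: the unique weight center if $|W(G)|=1$; all vertices of the central block if $|W(G)|\ge 2$. The level of $v$ is $L(v)=\min\{d(v,w): w \text{ a central vertex}\}$ and $L(G)=\sum_{v\in V(G)}L(v)$. Set $\varepsilon(G)=1$ if $|W(G)|=1$ and $\varepsilon(G)=0$ if $|W(G)|\ge2$. If $u$ lies on the $(w,v)$-geodesic for some central vertex $w$, then $u$ is an ancestor of $v$ and $v$ a descendant of $u$. A non-central block $D$ containing a central vertex $w$ is said to be adjacent to $w$; the subgraph induced by $V(D)\setminus\{w\}$ together with the descendants of these vertices is a branch. Two branches are different if they come from two different blocks adjacent to the same central vertex, and opposite if they come from blocks adjacent to different central vertices; two vertices are in different (opposite) branches if they belong to different (opposite) branches. $\phi(u,v)=\max\{L(x): x\text{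 is a common ancestor of }u\text{ and }v\}$. $\delta(u,v)=1$ if $P_{uv}$ contains two central vertices, and $0$ otherwise. $\rho(u,v)=0$ if $P_{uv}$ contains a central vertex or a common ancestor of $u$ and $v$, and $\rho(u,v)=1$ otherwise. In condition (b), the precise meaning (also when one of the vertices is a central vertex) is the one given by the ''i.e.'' clause. *)

(* Defs.v *)
From mathcomp Require Import all_boot all_order all_algebra.
From mathcomp Require Import boolp.

Set Implicit Arguments.
Unset Strict Implicit.
Unset Printing Implicit Defensive.

Section GraphNotions.
Variables (T : finType) (e : rel T).

Definition simple_graph : Prop := symmetric e /\ irreflexive e.

(* Length of a shortest path from x to y, or #|T| if y is unreachable from x. *)
Definition dist (x y : T) : nat :=
  find (fun n => [exists p : n.-tuple T, path e x p && (last x p == y)])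
       (iota 0 #|T|).

Definition diam : nat := \max_(x : T) \max_(y : T) dist x y.

(* The truncated subtraction is harmless, as dist u v <= diam. *)
Definition radio_labeling (f : T -> nat) : bool :=
  [forall u, forall v, (u != v) ==> (diam.+1 - dist u v <= `|f u - f v|)].

Definition span (f : T -> nat) : nat := \max_(u : T) \max_(v : T) `|f u - f v|.

Lemma ex_radio_labeling :
  exists n, `[< exists2 f : T -> nat, radio_labeling f & span f = n >].
Proof.
pose f (x : T) := enum_rank x * diam.+1.
exists (span f); apply/asboolP; exists f => //.
apply/forallP => u; apply/forallP => v; apply/implyP => neq_uv.
apply: leq_trans (leq_subr _ _) _.
rewrite /f !PoszM -GRing.mulrBl abszM leq_pmull // absz_gt0 GRing.subr_eq0.
by rewrite eqz_nat (inj_eq val_inj) (inj_eq enum_rank_inj).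
Qed.

Definition radio_number : nat := ex_minn ex_radio_labeling.

Definition induced (S : {set T}) : rel T :=
  [rel x y | [&& x \in S, y \in S & e x y]].

Definition connected (S : {set T}) : bool :=
  [forall x in S, forall y in S, connect (induced S) x y].

(* Deleting v separates two vertices joined in the subgraph induced by S. *)
Definition cut_vertex (S : {set T}) (v : T) : bool :=
  (v \in S) && [exists x in S :\ v, exists y in S :\ v,
    connect (induced S) x y && ~~ connect (induced (S :\ v)) x y].

Definition block (B : {set T}) : bool :=
  maxset (fun S => connected S && [forall v, ~~ cut_vertex S v]) B.

Definition complete (S : {set T}) : bool :=
  [forall x in S, forall y in S, (x != y) ==> e x y].

Definition block_graph : Prop :=
  connected [set: T] /\ forall B : {set T}, block B -> complete B.

Definition weight (v : T) : nat := \sum_(u : T) dist u v.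

Definition weight_centers : {set T} :=
  [set v | [forall u, weight v <= weight u]].

Definition eps : nat := #|weight_centers| == 1.

(* In a block graph with at least two weight centers there is exactly one
   such B, so that the union in central is that block. *)
Definition central_block (B : {set T}) : bool :=
  [&& 2 <= #|weight_centers|, block B & weight_centers \subset B].

Definition central : {set T} :=
  if #|weight_centers| == 1 then weight_centers
  else \bigcup_(B | central_block B) B.

(* In a connected graph all distances are smaller than #|T|, so that the default
   value of this minimum is never reached when there is a central vertex. *)
Definition level (v : T) : nat := \big[minn/#|T|]_(w in central) dist v w.

Definition total_level : nat := \sum_(v : T) level v.

(* The vertices on the shortest paths from u to v; in a block graph there is
   only one such path. *)
Definition geodesic (u v : T) : {set T} :=
  [set x | [exists p : (dist u v).-tuple T,
    [&& path e u p, last u p == v & x \in u :: p]]].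

Definition ancestor (u v : T) : bool :=
  [exists w in central, u \in geodesic w v].

Definition common_ancestor (u v x : T) : bool := ancestor x u && ancestor x v.

Definition phi (u v : T) : nat := \max_(x | common_ancestor u v x) level x.

Definition delta (u v : T) : nat := 2 <= #|geodesic u v :&: central|.

Definition rho (u v : T) : nat :=
  ~~ [exists x in geodesic u v, (x \in central) || common_ancestor u v x].

(* The vertices are listed as u 0, ..., u (#|T| - 1); the further values of u
   are irrelevant. *)
Definition ordering (u : nat -> T) : Prop :=
  {in [pred i | i < #|T|] &, injective u} /\
  (forall x : T, exists2 i, i < #|T| & u i = x).

End GraphNotions.

(* Main.v *)
Require Import Defs.
From mathcomp Require Import all_boot all_order all_algebra.
From mathcomp Require Import boolp zify.

Set Implicit Arguments.
Unset Strict Implicit.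
Unset Printing Implicit Defensive.

(** Write L for the level, d for the diameter and eps for [eps e].  Two central
vertices are equal if eps = 1, and they lie in the complete central block
otherwise, so they are at distance at most 1 - eps ([central_dist]).  Going from
u to v through their nearest central vertices therefore gives
dist u v <= L(u) + L(v) + 1 - eps ([dist_le_levels]).

Take a radio labeling f and list the vertices u_0, u_1, ... by increasing
label.  The radio condition on consecutive vertices becomes
f(u_(i+1)) - f(u_i) >= d + eps - L(u_i) - L(u_(i+1)), and the difference of the
two sides is called the excess at i.  The label differences telescope to the
span, while every level is counted twice except those of the two ends, so
  span f = bound + (L(u_0) + L(u_(p-1)) - eps) + sum of the excesses
([span_excess]).  Both corrections are nonnegative: a single weight center is
the only vertex of level 0, so it cannot sit at both ends ([level_ends]).  This
is the lower bound.

If the bound is reached, both corrections vanish.  The vanishing of the first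
one is (a); that of the excesses is (c), and it forces
dist u_i u_(i+1) = L(u_i) + L(u_(i+1)) + 1 - eps.  The walk through the nearest
central vertices is then a shortest one, and a common ancestor of positive level
would give a shortcut, which is (b) ([tight_dist_levels]).  Conversely, (b) gives
L(u_i) + L(u_(i+1)) <= dist u_i u_(i+1) <= d ([levels_le_dist]), so the labels of
(c) increase along the ordering; then [span_excess] applies to them, and both
corrections are zero. *)

(** * Distances and geodesics *)

Section Distance.
Variables (T : finType) (e : rel T).

Lemma dist_le_card x y : dist e x y <= #|T|.
Proof. by rewrite -[leqRHS](size_iota 0) find_size. Qed.

Lemma dist_le_path x p : path e x p -> dist e x (last x p) <= size p.
Proof.
move=> xp; rewrite leqNgt; apply/negP => lt_p.
have lt_pT := leq_trans lt_p (dist_le_card _ _).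
have := before_find 0 lt_p; rewrite nth_iota // => /existsP; apply.
by exists (in_tuple p); rewrite /= xp /=.
Qed.

Lemma dist_path x y : dist e x y < #|T| ->
  exists p, [/\ path e x p, last x p = y & size p = dist e x y].
Proof.
move=> lt_xy; have := lt_xy; rewrite -[X in _ < X](size_iota 0) -has_find.
move=> /(nth_find 0); rewrite nth_iota // add0n => /existsP[p /andP[xp /eqP Ep]].
by exists p; split=> //; rewrite size_tuple.
Qed.

(** A distance that is not realized by a walk has the value #|T|, which bounds
all distances, so the inequality also holds across components. *)
Lemma dist_triangle y x z : dist e x z <= dist e x y + dist e y z.
Proof.
have le_xz := dist_le_card x z.
have [ltxy|] := ltnP (dist e x y) #|T|; last lia.
have [ltyz|] := ltnP (dist e y z) #|T|; last lia.
have [p [xp Ep <-]] := dist_path ltxy.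
have [q [yq <- <-]] := dist_path ltyz.
rewrite -{1}Ep -last_cat -size_cat; apply: dist_le_path.
by rewrite cat_path xp Ep.
Qed.

Lemma distxx x : dist e x x = 0.
Proof. by apply/eqP; rewrite -leqn0; have := @dist_le_path x [::]; apply. Qed.

Lemma dist_edge x y : e x y -> dist e x y <= 1.
Proof. by move=> xy; have := @dist_le_path x [:: y]; apply; rewrite /= xy. Qed.

Lemma dist_eq0 x y : dist e x y = 0 -> x = y.
Proof.
move=> d0; have /dist_path[p [_ Ep]] : dist e x y < #|T|.
  by rewrite d0; apply/card_gt0P; exists x.
by rewrite d0 => /size0nil p0; rewrite -Ep p0.
Qed.

Lemma dist_le_diam x y : dist e x y <= diam e.
Proof.
apply: (@leq_trans (\max_(z : T) dist e x z)); first exact: leq_bigmax_cond.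
exact: (@leq_bigmax_cond _ xpredT (fun x => \max_(z : T) dist e x z)).
Qed.

Lemma geodesic_dist u v x :
  x \in geodesic e u v -> dist e u x + dist e x v <= dist e u v.
Proof.
rewrite inE => /existsP[p /and3P[up /eqP Ep xp]].
have := size_tuple p; move: (tval p) up Ep xp => {}p up Ep xp.
case/splitPl: xp up Ep => p1 p2 <-.
rewrite cat_path last_cat size_cat => /andP[up1 up2] <- <-.
by rewrite leq_add // dist_le_path.
Qed.

Lemma connected_dist_lt x y : connected e [set: T] -> dist e x y < #|T|.
Proof.
move=> /forallP/(_ x); rewrite inE => /forallP/(_ y); rewrite inE.
move=> /connectP[p xp ->].
have {}xp : path e x p by apply: sub_path xp => a b /and3P[].
case/shortenP: xp => q xq Uq _; apply: leq_ltn_trans (dist_le_path xq) _.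
by rewrite -(card_uniqP Uq : #|x :: q| = (size q).+1) max_card.
Qed.

Lemma mem_geodesic u v x : dist e u v < #|T| ->
  dist e u x + dist e x v <= dist e u v -> x \in geodesic e u v.
Proof.
move=> lt_uv le_uv; have tri := dist_triangle x u v.
have [|p [up Ep Sp]] := @dist_path u x; first lia.
have [|q [xq Eq Sq]] := @dist_path x v; first lia.
have Spq : size (p ++ q) == dist e u v by rewrite size_cat; lia.
rewrite inE; apply/existsP; exists (Tuple Spq) => /=.
by rewrite cat_path up last_cat Ep xq Eq eqxx /= -cat_cons mem_cat -Ep mem_last.
Qed.

Lemma dist_sym x y : symmetric e -> dist e x y = dist e y x.
Proof.
move=> sym_e; suff le_d a b : dist e a b <= dist e b a.
  by apply/eqP; rewrite eqn_leq !le_d.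
have [lt_ba|le_T] := ltnP (dist e b a) #|T|; last first.
  exact: leq_trans (dist_le_card _ _) le_T.
have [p [bp Ep <-]] := dist_path lt_ba.
have := @dist_le_path a (rev (belast b p)).
rewrite size_rev size_belast -{1}Ep rev_path (eq_path (e' := e)) //.
move=> /(_ bp); case: p {bp} Ep => [|c p] /= Ep; first by rewrite Ep.
by rewrite rev_cons last_rcons.
Qed.

End Distance.

(** * The central vertices *)

Section Blocks.
Variables (T : finType) (e : rel T).

(** If x and y are common to two complete blocks, then whichever vertex is
deleted from their union, one of x and y remains, and it is adjacent to all other
remaining vertices.  The union has thus no cut vertex, and maximality makes both
blocks equal to it. *)
Lemma block_eq (B C : {set T}) x y :
  block e B -> complete e B -> block e C -> complete e C ->
  x != y -> x \in B :&: C -> y \in B :&: C -> B = C.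
Proof.
move=> blB cB blC cC neq_xy; rewrite !inE => /andP[xB xC] /andP[yB yC].
have mxB := maxsetP blB; have mxC := maxsetP blC.
suff ok : connected e (B :|: C) && [forall v, ~~ cut_vertex e (B :|: C) v].
  by rewrite -(mxB.2 _ ok (subsetUl _ _)) (mxC.2 _ ok (subsetUr _ _)).
have edge a b : a \in B :|: C -> (b \in B :&: C) -> a != b -> e a b && e b a.
  rewrite !inE => /orP[aS|aS] /andP[bB bC] neq_ab.
    move/forall_inP: cB => cB.
    by rewrite !(implyP (forall_inP (cB _ _) _ _)) // eq_sym.
  move/forall_inP: cC => cC.
  by rewrite !(implyP (forall_inP (cC _ _) _ _)) // eq_sym.
(* Any two vertices of S are joined through z. *)
have star (S : {set T}) z a b : S \subset B :|: C -> z \in S -> z \in B :&: C ->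
    a \in S -> b \in S -> connect (induced e S) a b.
  move=> /subsetP sS zS zBC aS bS; apply: (@connect_trans _ _ z).
    have [->|neq] := eqVneq a z; first exact: connect0.
    by apply: connect1; rewrite /induced /= aS zS; case/andP: (edge a z (sS _ aS) zBC neq).
  have [->|neq] := eqVneq b z; first exact: connect0.
  by apply: connect1; rewrite /induced /= bS zS; case/andP: (edge b z (sS _ bS) zBC neq).
apply/andP; split.
  apply/forall_inP => a aS; apply/forall_inP => b bS.
  by apply: (star _ x); rewrite // !inE ?xB ?xC.
apply/forallP => v; rewrite /cut_vertex negb_and negb_exists_in; apply/orP; right.
apply/forall_inP => a aS; rewrite negb_exists_in; apply/forall_inP => b bS.
rewrite negb_and negbK; apply/orP; right.
have [eq_vx|neq_vx] := eqVneq x v.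
  apply: (star _ y); rewrite ?subD1set // !inE ?yB ?yC // -eq_vx eq_sym.
  by rewrite neq_xy.
by apply: (star _ x); rewrite ?subD1set // !inE ?xB ?xC // neq_vx.
Qed.

Hypothesis block_e : block_graph e.

(** When there are several weight centers, two central blocks share at least two
vertices, hence are equal, so that the central vertices form a clique. *)
Lemma central_dist w w' : w \in central e -> w' \in central e ->
  dist e w w' <= 1 - eps e.
Proof.
rewrite /central /eps; case: ifP => [W1|_].
  by case/cards1P: W1 => c ->; rewrite !inE => /eqP-> /eqP->; rewrite distxx.
move=> /bigcupP[B /and3P[W2 blB sWB] wB] /bigcupP[C /and3P[_ blC sWC] w'C].
have [cB cC] := (block_e.2 _ blB, block_e.2 _ blC).
case/card_gt1P: W2 => x [y [xW yW neq_xy]].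
have eqBC : B = C.
  apply: (block_eq blB cB blC cC neq_xy); rewrite inE.
    by rewrite (subsetP sWB) ?(subsetP sWC).
  by rewrite (subsetP sWB) ?(subsetP sWC).
rewrite -eqBC in w'C; have [->|neq] := eqVneq w w'; first by rewrite distxx.
by apply: dist_edge; apply: (implyP (forall_inP (forall_inP cB _ _) _ _)).
Qed.

End Blocks.

(** * Distances and levels *)

Section Levels.
Variables (T : finType) (e : rel T).

Lemma level_le w v : w \in central e -> level e v <= dist e v w.
Proof.
move=> wC; rewrite /level; have := mem_index_enum w.
elim: (index_enum T) => //= x s IHs; rewrite inE big_cons.
case/predU1P=> [<-|/IHs le_s]; first by rewrite wC geq_minl.
by case: ifP => // _; apply: leq_trans (geq_minr _ _) le_s.
Qed.

(** The first alternative makes the level of v at least every distance, which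
settles there the comparisons of distances with levels. *)
Lemma levelP v : level e v = #|T| \/
  exists2 w, w \in central e & level e v = dist e v w.
Proof.
rewrite /level; elim/big_ind: _ => [|m n IHm IHn|w wC]; first by left.
  by case: leqP.
by right; exists w.
Qed.

Lemma level0_central v : level e v = 0 -> v \in central e.
Proof.
have [-> T0|[w wC ->] /dist_eq0->//] := levelP v.
by have := card0_eq T0 v; rewrite inE.
Qed.

(** By [rho] = 0 some vertex of a geodesic is central or a common ancestor; by
[phi] = 0 such an ancestor has level 0 and is central too.  The geodesic is cut
there into two parts that reach the central vertices. *)
Lemma levels_le_dist u v : rho e u v = 0 -> phi e u v = 0 ->
  symmetric e -> level e u + level e v <= dist e u v.
Proof.
move=> /eqP; rewrite eqb0 negbK => /exists_inP[x /geodesic_dist le_d xP].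
move=> phi0 sym_e; suff xC : x \in central e.
  apply: leq_trans le_d; rewrite (dist_sym x v sym_e).
  by rewrite leq_add // level_le.
case/orP: xP => // xA; apply: level0_central; apply/eqP; rewrite -leqn0 -phi0.
exact: (@leq_bigmax_cond _ (common_ancestor e u v) (level e)).
Qed.

Hypotheses (simple_e : simple_graph e) (block_e : block_graph e).

Lemma dist_le_levels u v : dist e u v <= level e u + level e v + (1 - eps e).
Proof.
have [le_uv dsym] := (dist_le_card e u v, fun a b => dist_sym a b simple_e.1).
have [->|[w wC ->]] := levelP u; first lia.
have [->|[w' w'C ->]] := levelP v; first lia.
have := central_dist block_e wC w'C.
have := dist_triangle e w u v; have := dist_triangle e w' w v.
by rewrite (dsym v); lia.
Qed.

(** The nearest central vertices w of u and w' of v lie on a geodesic, at distance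
1 - eps from each other, which gives [rho] and [delta].  A common ancestor x lies
between u and a central vertex at distance at most L(u) + 1 - eps, so that
dist u x <= L(u) + 1 - eps - L(x), and likewise for v.  Joining u to v through x
then gives L(u) + L(v) + 1 - eps <= L(u) + L(v) + 2 (1 - eps) - 2 L(x), which
forces L(x) = 0. *)
Lemma tight_dist_levels u v : level e u + level e v + (1 - eps e) <= dist e u v ->
  [/\ rho e u v = 0, phi e u v = 0 & delta e u v = 1 - eps e].
Proof.
have dsym a b := dist_sym a b simple_e.1.
have lt_uv a b : dist e a b < #|T| := connected_dist_lt a b block_e.1.
move=> tight; have lt := lt_uv u v.
have [|[w wC Lu]] := levelP u; first lia.
have [|[w' w'C Lv]] := levelP v; first lia.
have ww' := central_dist block_e wC w'C.
have tri_u := dist_triangle e w u v; have tri_v := dist_triangle e w' w v.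
have tri_u' := dist_triangle e w u w'.
have vw := dsym v w'.
have gw : w \in geodesic e u v by apply: mem_geodesic; lia.
have gw' : w' \in geodesic e u v by apply: mem_geodesic; lia.
split.
- by apply/eqP; rewrite eqb0 negbK; apply/exists_inP; exists w; rewrite ?wC.
- apply/eqP; rewrite -leqn0; apply/bigmax_leqP => x /andP[].
  move=> /exists_inP[a aC /geodesic_dist aux] /exists_inP[b bC /geodesic_dist bvx].
  have [wa w'b] := (central_dist block_e wC aC, central_dist block_e w'C bC).
  have := level_le x aC; have := level_le x bC.
  have := dist_triangle e w u a; have := dist_triangle e w' v b.
  have := dist_triangle e x u v.
  have := (dsym x a, dsym x b, dsym u a, dsym v b, dsym x u).
  move=> [[[[]]]]; lia.
rewrite /delta; have [eps1|eps0] := boolP (eps e == 1).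
  rewrite (eqP eps1); apply/eqP; rewrite eqb0 -leqNgt.
  have W1 : #|weight_centers e| = 1 by move: eps1; rewrite /eps eqb1 => /eqP.
  apply: leq_trans (subset_leq_card (subsetIr _ _)) _.
  by rewrite /central W1 eqxx W1.
have {}eps0 : eps e = 0 by move: eps0; rewrite /eps eqb1 => /negbTE->.
rewrite eps0 in tight ww' *; suff -> : 1 < #|geodesic e u v :&: central e| by [].
apply/card_gt1P; exists w, w'; split; rewrite ?in_setI ?gw ?gw' //.
by apply/eqP => eq_w; subst w'; lia.
Qed.

End Levels.

(** * Labels along an ordering *)

Section Labelings.
Variables (T : finType) (e : rel T).

Lemma span_monotone (u : nat -> T) (f : T -> nat) : 0 < #|T| -> ordering u ->
  (forall i, i.+1 < #|T| -> f (u i) <= f (u i.+1)) ->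
  Defs.span f = f (u #|T|.-1) - f (u 0).
Proof.
move=> T0 [_ surj_u] f_mono.
have mono i j : i <= j -> j < #|T| -> f (u i) <= f (u j).
  elim: j => [|j IHj]; first by rewrite leqn0 => /eqP->.
  rewrite leq_eqVlt => /predU1P[->//|le_ij] lt_j.
  by apply: leq_trans (f_mono _ lt_j); apply: IHj; [exact: le_ij | exact: ltnW].
have range x : f (u 0) <= f x <= f (u #|T|.-1).
  by have [i lt_i <-] := surj_u x; rewrite !mono //; lia.
apply/eqP; rewrite eqn_leq; apply/andP; split.
  apply/bigmax_leqP => x _; apply/bigmax_leqP => y _.
  by have := (range x, range y); case; lia.
have le_span x y : `|f x - f y| <= Defs.span f.
  apply: leq_trans (@leq_bigmax_cond _ xpredT (fun y => `|f x - f y|) y isT) _.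
  exact: (@leq_bigmax_cond _ xpredT (fun x => \max_y `|f x - f y|)).
by have := le_span (u #|T|.-1) (u 0); lia.
Qed.

Lemma sum_ordering (u : nat -> T) (F : T -> nat) : ordering u ->
  \sum_x F x = \sum_(0 <= i < #|T|) F (u i).
Proof.
move=> [inj_u _]; rewrite big_mkord (reindex (fun i : 'I_#|T| => u i)) //.
apply/onW_bij/inj_card_bij; last by rewrite card_ord.
by move=> i j /inj_u; rewrite !inE !ltn_ord => /(_ isT isT)/val_inj.
Qed.

Lemma sorted_ordering (f : T -> nat) (x0 : T) :
  exists2 u : nat -> T, ordering u &
    forall i, i.+1 < #|T| -> f (u i) <= f (u i.+1).
Proof.
set r := relpre f leq; set s := sort r (enum T).
have Ss : size s = #|T| by rewrite size_sort -cardE.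
exists (nth x0 s); first split.
- move=> i j; rewrite !inE -Ss => lt_i lt_j /eqP.
  by rewrite nth_uniq ?sort_uniq ?enum_uniq // => /eqP.
- move=> x; have xs : x \in s by rewrite mem_sort mem_enum.
  by exists (index x s); [rewrite -Ss index_mem | rewrite nth_index].
move=> i; rewrite -Ss => lt_i; apply: (@sorted_ltn_nth _ r _ x0 s) => //.
- by move=> y x z; apply: leq_trans.
- by apply: sort_sorted => x y; apply: leq_total.
by rewrite inE ltnW.
Qed.

End Labelings.

(** * The excess of a labeling *)

Import GRing.Theory Num.Theory.

Section Bound.
Variables (T : finType) (e : rel T).

Definition span_bound : int :=
  ((#|T|%:Z - 1) * ((diam e)%:Z + (eps e)%:Z) - 2 * (total_level e)%:Z
    + (eps e)%:Z)%R.

(** By how much a label difference exceeds its lower bound. *)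
Definition excess (u : nat -> T) (f : T -> nat) (i : nat) : int :=
  ((f (u i.+1))%:Z - (f (u i))%:Z
   - ((diam e)%:Z + (eps e)%:Z - (level e (u i.+1))%:Z - (level e (u i))%:Z))%R.

Lemma sum_excess u f n :
  (\sum_(0 <= i < n) excess u f i
   = (f (u n))%:Z - (f (u 0%N))%:Z - n%:Z * ((diam e)%:Z + (eps e)%:Z)
     + (\sum_(0 <= i < n) level e (u i.+1))%:Z
     + (\sum_(0 <= i < n) level e (u i))%:Z)%R.
Proof.
elim: n => [|n IHn]; first by rewrite !big_geq //; lia.
by rewrite !big_nat_recr //= IHn /excess; lia.
Qed.

(** The basic identity: the optimality of a labeling is the vanishing of two
corrections that are nonnegative for every radio labeling. *)
Lemma span_excess (u : nat -> T) (f : T -> nat) : 0 < #|T| -> ordering u ->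
  (forall i, i.+1 < #|T| -> f (u i) <= f (u i.+1)) ->
  ((Defs.span f)%:Z = span_bound
     + ((level e (u 0%N) + level e (u #|T|.-1))%:Z - (eps e)%:Z)
     + \sum_(0 <= i < #|T|.-1) excess u f i)%R.
Proof.
move=> T0 ord_u f_mono; rewrite (span_monotone T0 ord_u f_mono).
have le_f : f (u 0) <= f (u #|T|.-1).
  move: f_mono; rewrite -(prednK T0) /=; elim: #|T|.-1 => // n IHn f_mono.
  by apply: leq_trans (f_mono n _); rewrite // IHn // => i lt_i; apply/f_mono/ltnW.
have sumL : total_level e = \sum_(0 <= i < #|T|.-1.+1) level e (u i).
  by rewrite prednK //; apply: sum_ordering.
have sum_last : total_level e
    = \sum_(0 <= i < #|T|.-1) level e (u i) + level e (u #|T|.-1).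
  by rewrite sumL big_nat_recr.
have sum_first : total_level e
    = level e (u 0) + \sum_(0 <= i < #|T|.-1) level e (u i.+1).
  by rewrite sumL big_nat_recl.
rewrite sum_excess /span_bound.
have -> : (#|T|%:Z = #|T|.-1%:Z + 1)%R by lia.
by clear sumL; lia.
Qed.

Hypotheses (simple_e : simple_graph e) (block_e : block_graph e).

Lemma radio_gap f u v : radio_labeling e f -> u != v ->
  diam e < `|f u - f v| + dist e u v.
Proof.
move=> /forallP/(_ u)/forallP/(_ v)/implyP rad_f /rad_f.
by have := dist_le_diam e u v; lia.
Qed.

(** The excess dominates the slack in the bound of a distance by levels; it is
therefore nonnegative, and zero only for a tight distance. *)
Lemma radio_excess u f i : ordering u -> radio_labeling e f ->
  i.+1 < #|T| -> f (u i) <= f (u i.+1) ->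
  ((level e (u i) + level e (u i.+1) + (1 - eps e))%:Z
     - (dist e (u i) (u i.+1))%:Z <= excess u f i)%R.
Proof.
move=> [inj_u _] rad_f lt_i le_f.
have neq_u : u i != u i.+1.
  by apply/eqP => /inj_u; rewrite !inE (ltnW lt_i) lt_i => /(_ isT isT); lia.
have := radio_gap rad_f neq_u; rewrite /excess.
by have : eps e <= 1 := leq_b1 _; lia.
Qed.

Lemma excess_ge0 u f i : ordering u -> radio_labeling e f ->
  i.+1 < #|T| -> f (u i) <= f (u i.+1) -> (0 <= excess u f i)%R.
Proof.
move=> ord_u rad_f lt_i le_f; have := radio_excess ord_u rad_f lt_i le_f.
by have := dist_le_levels simple_e block_e (u i) (u i.+1); lia.
Qed.

(** For a single weight center, the two ends of the ordering are distinct and only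
one vertex has level 0. *)
Lemma level_ends u : ordering u -> 1 < #|T| ->
  eps e <= level e (u 0) + level e (u #|T|.-1).
Proof.
move=> [inj_u _] T_gt1; rewrite /eps; case: eqP => //= W1; rewrite lt0n.
apply/eqP => /eqP; rewrite addn_eq0 => /andP[/eqP/level0_central L0].
move=> /eqP/level0_central; move: L0; rewrite /central W1 eqxx.
move/eqP/cards1P: W1 => [w ->]; rewrite !inE => /eqP<- /eqP/inj_u eq_ends.
have : #|T|.-1 = 0 by apply: eq_ends; rewrite inE ?ltn_predL ltnW.
by move: T_gt1; clear; lia.
Qed.

Lemma radio_numberP : exists2 f, radio_labeling e f & Defs.span f = radio_number e.
Proof. by rewrite /radio_number; case: ex_minnP => n /asboolP. Qed.

Lemma radio_number_le f : radio_labeling e f -> radio_number e <= Defs.span f.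
Proof.
rewrite /radio_number; case: ex_minnP => n _ min_n rad_f; apply: min_n.
by apply/asboolP; exists f.
Qed.

Lemma radio_labeling_shift f c : (forall x, c <= f x) ->
  radio_labeling e f -> radio_labeling e (fun x => f x - c).
Proof.
move=> le_c /forallP rad_f; apply/forallP => x; apply/forallP => y.
apply/implyP => neq_xy; move: (implyP (forallP (rad_f x) y) neq_xy).
by have := (le_c x, le_c y); case; lia.
Qed.

Lemma radio_span_ge u f : 1 < #|T| -> ordering u -> radio_labeling e f ->
  (forall i, i.+1 < #|T| -> f (u i) <= f (u i.+1)) ->
  (span_bound <= (Defs.span f)%:Z)%R.
Proof.
move=> T_gt1 ord_u rad_f f_mono; rewrite (span_excess (ltnW T_gt1) ord_u f_mono).
have := level_ends ord_u T_gt1.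
have : (0 <= \sum_(0 <= i < #|T|.-1) excess u f i)%R; last lia.
rewrite big_nat_cond; apply: sumr_ge0 => i; rewrite andbT => /andP[_ lt_i].
have lt_i1 : i.+1 < #|T| by lia.
exact: excess_ge0 lt_i1 (f_mono _ lt_i1).
Qed.

Lemma optimal_tight u f : 1 < #|T| -> ordering u -> radio_labeling e f ->
  (forall i, i.+1 < #|T| -> f (u i) <= f (u i.+1)) ->
  (Defs.span f)%:Z%R = span_bound ->
  level e (u 0) + level e (u #|T|.-1) = eps e /\
  forall i, i.+1 < #|T| -> excess u f i = 0%R.
Proof.
move=> T_gt1 ord_u rad_f f_mono; rewrite (span_excess (ltnW T_gt1) ord_u f_mono).
have ends := level_ends ord_u T_gt1.
have ge0 i : 0 <= i < #|T|.-1 -> (0 <= excess u f i)%R.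
  move=> lt_i; have lt_i1 : i.+1 < #|T| by lia.
  exact: excess_ge0 lt_i1 (f_mono _ lt_i1).
rewrite big_nat; set S := (\sum_(0 <= i < _ | _) _)%R => opt.
have S_ge0 : (0 <= S)%R by exact: sumr_ge0.
split=> [|i lt_i]; first by clearbody S; lia.
have sum0 : S = 0%R by clearbody S; lia.
move/eqP: sum0; rewrite /S psumr_eq0 // => /allP/(_ i).
have lt_i1 : i < #|T|.-1 by lia.
by rewrite mem_index_iota /= lt_i1 => /(_ isT)/eqP.
Qed.

End Bound.

Theorem theorem3p1 (T : finType) (e : rel T)
    (simple_e : simple_graph e) (block_e : block_graph e)
    (diam_ge2 : 2 <= diam e) :
  let bound : int :=
    ((#|T|%:Z - 1) * ((diam e)%:Z + (eps e)%:Z) - 2 * (total_level e)%:Z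
      + (eps e)%:Z)%R in
  (bound <= (radio_number e)%:Z)%R /\
  (((radio_number e)%:Z = bound)%R <->
   exists u : nat -> T,
     [/\ ordering u,
         level e (u 0) + level e (u #|T|.-1) = eps e,
         forall i, i.+1 < #|T| ->
           [/\ rho e (u i) (u i.+1) = 0, phi e (u i) (u i.+1) = 0
             & delta e (u i) (u i.+1) = 1 - eps e]
       & exists f : T -> nat,
           [/\ f (u 0) = 0,
               forall i, i.+1 < #|T| ->
                 ((f (u i.+1))%:Z
                  = (f (u i))%:Z + (diam e)%:Z + (eps e)%:Z
                    - (level e (u i.+1))%:Z - (level e (u i))%:Z)%R
             & radio_labeling e f]]).
Proof.
move=> bound; have T_gt1 : 1 < #|T|.
  apply: leq_trans diam_ge2 _; apply/bigmax_leqP => x _; apply/bigmax_leqP => y _.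
  exact: dist_le_card.
have [x0 _] : exists x0 : T, x0 \in predT by apply/card_gt0P; exact: ltnW.
have [f rad_f span_f] := radio_numberP e.
have [u ord_u f_mono] := sorted_ordering f x0.
have lower : (bound <= (radio_number e)%:Z)%R.
  by rewrite -span_f; apply: radio_span_ge f_mono.
split=> //; split=> [opt|[{rad_f span_f ord_u f_mono}u]].
  rewrite -span_f in opt.
  have [ends tight] := optimal_tight simple_e block_e T_gt1 ord_u rad_f f_mono opt.
  exists u; split=> // [i lt_i|].
    apply: tight_dist_levels => //.
    by have := radio_excess ord_u rad_f lt_i (f_mono _ lt_i); rewrite tight //; lia.
  have f_min x : f (u 0) <= f x.
    have [i lt_i <-] := ord_u.2 x; elim: i lt_i => // i IHi lt_i.
    by apply: leq_trans (f_mono _ lt_i); apply/IHi/ltnW.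
  (* Only label differences matter, so the least label can be moved to 0. *)
  exists (fun x => f x - f (u 0)); split; rewrite ?subnn //.
    move=> i lt_i; have := tight i lt_i; rewrite /excess.
    by have := (f_min (u i), f_min (u i.+1)); case; lia.
  exact: radio_labeling_shift.
case=> ord_u ends far [g [g0 g_step rad_g]].
(* Sortedness of the prescribed labels is what makes their span computable. *)
have g_mono i : i.+1 < #|T| -> g (u i) <= g (u i.+1).
  move=> lt_i; have [rho0 phi0 _] := far i lt_i; have := g_step i lt_i.
  have := levels_le_dist rho0 phi0 simple_e.1.
  by have := dist_le_diam e (u i) (u i.+1); lia.
apply/eqP; rewrite Order.POrderTheory.eq_le lower andbT.
have -> : bound = (Defs.span g)%:Z%R; last by rewrite lez_nat radio_number_le.
rewrite (span_excess e (ltnW T_gt1) ord_u g_mono) ends subrr addr0.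
rewrite big_nat big1 ?addr0 // => i lt_i; rewrite /excess g_step; lia.
Qed.
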